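(* Let $\mu:\mathcal{P}(\mathcal{C})\to L^*$ be a capacity and $f:\mathcal{C}\to L^*$ an input vector. Then $\int_{\mathrm{DPR},\mu}^{\otimes_D} f=0$ if and only if $\mu(\{i\in\mathcal{C}\mid f_i>_\ell 0\})=0$.
   Context: Residuated lattice: $L=(L,\wedge,\vee,\otimes,\to,0,1)$ is a linearly ordered residuated lattice: $(L,\wedge,\vee,0,1)$ is a linearly ordered lattice with bottom $0$ and top $1$ ($0\neq 1$), $(L,\otimes,1)$ is a commutative monoid, and $\alpha\otimes\beta\le\gamma$ iff $\alpha\le\beta\to\gamma$. The underlying ordered set of $L$ is either a closed real interval $[a,b]$ with $a<b$ or a finite subset of $[a,b]$ containing $a$ and $b$ (with $0,1$ denoting the bottom and top elements). Standing assumption: $L$ has no zero divisors with respect to $\otimes$, i.e. $\alpha\otimes\beta=0$ implies $\alpha=0$ or $\beta=0$. Dragonfly algebra: $L^*=L\cup\{*\}$ with $*\notin L$ (the ''unknown value''). Its linear order $\le_\ell$ extends the order of $L$ by $0<_\ell *<_\ell\alpha$ for all $\alpha\in L\setminus\{0\}$; $\wedge_D,\vee_D$ are the minimum and maximum with respect to $\le_\ell$, and $\bigwedge_D,\bigvee_D$ denote infimum and supremum with respect to $\le_\ell$ (with $\bigwedge_D\emptyset=1$, $\bigvee_D\emptyset=0$). The multiplication $\otimes_D$ on $L^*$ is: $\alpha\otimes_D\beta=\alpha\otimes\beta$ for $\alpha,\beta\in L$; $*\otimes_D 0=0\otimes_D *=0$; $*\otimes_D\alpha=\alpha\otimes_D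 *=*$ for $\alpha\in L\setminus\{0\}$; $*\otimes_D *=*$. $\mathcal{C}=\{1,\dots,n\}$ is a finite non-empty set with power set $\mathcal{P}(\mathcal{C})$. An input vector is a map $f:\mathcal{C}\to L^*$, $f_i=f(i)$. A capacity is a map $\mu:\mathcal{P}(\mathcal{C})\to L^*$ with $\mu(\emptyset)=0$, $\mu(\mathcal{C})=1$, and $A\subseteq B\Rightarrow\mu(A)\le_\ell\mu(B)$. The multiplication-based qualitative integral is $$\int_{\mathrm{DPR},\mu}^{\otimes_D} f=\bigvee_{D,\,A\subseteq\mathcal{C}}\Big(\mu(A)\otimes_D\bigwedge_{D,\,i\in A}f_i\Big).$$ *)

(* Defs.v *)
From HB Require Import structures.
From mathcomp Require Import all_boot all_order all_algebra.
From mathcomp Require Import boolp classical_sets cardinality set_interval reals.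

Set Implicit Arguments.
Unset Strict Implicit.
Unset Printing Implicit Defensive.

Import Order.TTheory.

Local Open Scope order_scope.

(* A linearly ordered set of reals: a nondegenerate closed interval, or a finite
   subset of such an interval containing both endpoints. *)
Record real_chain (R : realType) := RealChain {
  chain_min : R;
  chain_max : R;
  chain_min_lt_max : chain_min < chain_max;
  chain_set : set R;
  chain_shape :
    chain_set = `[chain_min, chain_max]%classic \/
    [/\ finite_set chain_set,
        (chain_set `<=` `[chain_min, chain_max])%classic,
        chain_set chain_min & chain_set chain_max] }.

Section RealChainOrder.
Variables (R : realType) (C : real_chain R).

Definition chain_carrier : Type := set_type (chain_set C).

HB.instance Definition _ := SubChoice.on chain_carrier.
HB.instance Definition _ :=
  [SubChoice_isSubOrder of chain_carrier by <: with Order.Disp tt tt].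

Lemma chain_min_in : chain_min C \in chain_set C.
Proof.
rewrite inE; case: (chain_shape C) => [->|[]//].
by rewrite /= in_itv /= lexx ltW ?chain_min_lt_max.
Qed.

Lemma chain_max_in : chain_max C \in chain_set C.
Proof.
rewrite inE; case: (chain_shape C) => [->|[]//].
by rewrite /= in_itv /= lexx ltW ?chain_min_lt_max.
Qed.

Lemma chain_bounds (x : chain_carrier) : chain_min C <= val x <= chain_max C.
Proof.
have /set_mem xS := valP x.
suff : `[chain_min C, chain_max C]%classic (val x) by rewrite /= in_itv.
by case: (chain_shape C) => [<-//|[_ /(_ _ xS)]].
Qed.

Definition chain_bot : chain_carrier := Sub (chain_min C) chain_min_in.
Definition chain_top : chain_carrier := Sub (chain_max C) chain_max_in.

Lemma chain_le0x (x : chain_carrier) : chain_bot <= x.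
Proof. by rewrite -Order.le_val SubK; case/andP: (chain_bounds x). Qed.

Lemma chain_lex1 (x : chain_carrier) : x <= chain_top.
Proof. by rewrite -Order.le_val SubK; case/andP: (chain_bounds x). Qed.

HB.instance Definition _ := Order.hasBottom.Build _ chain_carrier chain_le0x.
HB.instance Definition _ := Order.hasTop.Build _ chain_carrier chain_lex1.

Lemma chain_bot_neq_top : (\bot : chain_carrier) != \top.
Proof.
apply/eqP => /(congr1 val) /= E.
by have := chain_min_lt_max C; rewrite E ltxx.
Qed.

End RealChainOrder.

Record residuation (R : realType) (C : real_chain R) := Residuation {
  tens : chain_carrier C -> chain_carrier C -> chain_carrier C;
  resid : chain_carrier C -> chain_carrier C -> chain_carrier C;
  tensA : associative tens;
  tensC : commutative tens;
  tens1x : left_id \top tens;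
  tens_adj : forall x y z, (tens x y <= z) = (x <= resid y z) }.

Definition no_zero_divisors (R : realType) (C : real_chain R)
    (Q : residuation C) : Prop :=
  forall x y, tens Q x y = \bot -> x = \bot \/ y = \bot.

Section Dragonfly.
Variables (R : realType) (C : real_chain R).
Local Notation L := (chain_carrier C).

Variant dragonfly := Known of L | Unknown.

Definition option_of_dragonfly x := if x is Known a then Some a else None.
Definition dragonfly_of_option o := if o is Some a then Known a else Unknown.
Lemma option_of_dragonflyK : cancel option_of_dragonfly dragonfly_of_option.
Proof. by case. Qed.

HB.instance Definition _ := Choice.copy dragonfly (can_type option_of_dragonflyK).

Definition dragonfly_le (x y : dragonfly) : bool :=
  match x, y with
  | Known a, Known b => a <= b
  | Known a, Unknown => a == \bot
  | Unknown, Known b => b != \bot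
  | Unknown, Unknown => true
  end.

Lemma dragonfly_le_refl : reflexive dragonfly_le.
Proof. by case=> /=. Qed.

Lemma dragonfly_le_anti : antisymmetric dragonfly_le.
Proof.
case=> [a|] [b|] //=; first by move/le_anti ->.
- by rewrite andbN.
- by rewrite andNb.
Qed.

Lemma dragonfly_le_trans : transitive dragonfly_le.
Proof.
case=> [b|] [a|] [c|] //=.
- exact: le_trans.
- by move=> ab /eqP b0; rewrite b0 lex0 in ab.
- by rewrite -!lt0x; apply: lt_le_trans.
- by move=> /eqP -> _; rewrite le0x.
Qed.

Lemma dragonfly_le_total : total dragonfly_le.
Proof.
case=> [a|] [b|] //=; first exact: le_total.
- by case: eqP.
- by case: eqP.
Qed.

HB.instance Definition _ := Order.Le_isPOrder.Build (Order.Disp tt tt) dragonfly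
  dragonfly_le_refl dragonfly_le_anti dragonfly_le_trans.
HB.instance Definition _ :=
  Order.POrder_isTotal.Build _ dragonfly dragonfly_le_total.

Lemma dragonfly_le0x (x : dragonfly) : Known \bot <= x.
Proof. by case: x => [a|]; rewrite /Order.le /= ?le0x ?eqxx. Qed.

Lemma dragonfly_lex1 (x : dragonfly) : x <= Known \top.
Proof.
by case: x => [a|]; rewrite /Order.le /= ?lex1 // eq_sym chain_bot_neq_top.
Qed.

HB.instance Definition _ := Order.hasBottom.Build _ dragonfly dragonfly_le0x.
HB.instance Definition _ := Order.hasTop.Build _ dragonfly dragonfly_lex1.

Definition dragonfly_tens (Q : residuation C) (x y : dragonfly) : dragonfly :=
  match x, y with
  | Known a, Known b => Known (tens Q a b)
  | Known a, Unknown | Unknown, Known a =>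
      if a == \bot then Known \bot else Unknown
  | Unknown, Unknown => Unknown
  end.

Definition capacity (T : finType) (mu : {set T} -> dragonfly) : Prop :=
  [/\ mu finset.set0 = \bot, mu [set: T]%SET = \top &
      forall A B : {set T}, A \subset B -> mu A <= mu B].

(* \meet over the empty set is \top. *)
Definition dpr_integral (Q : residuation C) (T : finType)
    (mu : {set T} -> dragonfly) (f : T -> dragonfly) : dragonfly :=
  \join_(A : {set T}) dragonfly_tens Q (mu A) (\meet_(i in A) f i).

End Dragonfly.
Arguments Unknown {R C}.

(* Main.v *)
Require Import Defs.
From mathcomp Require Import all_boot all_order all_algebra.
From mathcomp Require Import reals.

Import Order.TTheory.

(** A join is zero exactly when all its terms are, so the integral vanishes
    iff, for every [A], the product of [mu A] and the infimum of [f] over [A]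
    vanishes.  The absence of zero divisors extends from [L] to the dragonfly
    algebra ([dragonfly_tens_eq0]): the unknown value is nonzero, and it only
    gives zero when multiplied by zero.  Since the order is total and [A] is
    finite, an infimum is nonzero as soon as all its terms are
    ([meets_gt0]).

    Let [S] be the support of [f].  The infimum of [f] over [S] is nonzero
    (it is the top element, still nonzero, when [S] is empty), so the term
    [A = S] forces [mu S] to be zero if the integral is.  Conversely, let
    [mu S] be zero: a set [A] contained in [S] has zero capacity by
    monotonicity, and any other [A] contains a zero of [f], which makes the
    infimum of [f] over [A] zero. *)

Local Open Scope order_scope.

(** By residuation, multiplication by a fixed element has a right adjoint, so
    it preserves the bottom element. *)
Lemma tens0x (R : realType) (C : real_chain R) (Q : residuation C)
    (x : chain_carrier C) : tens Q \bot x = \bot.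
Proof. by apply/eqP; rewrite -lex0 tens_adj le0x. Qed.

Lemma dragonfly_tens_eq0 {R : realType} {C : real_chain R} {Q : residuation C}
    (hQ : no_zero_divisors Q) (x y : dragonfly C) :
  dragonfly_tens Q x y = \bot <-> x = \bot \/ y = \bot.
Proof.
case: x y => [a|] [b|] /=; split.
- by case=> /hQ [] ->; [left | right].
- by case=> -[->]; rewrite ?(tensC Q a) tens0x.
- by case: eqP => // ->; left.
- by case=> // -[->]; rewrite eqxx.
- by case: eqP => // ->; right.
- by case=> // -[->]; rewrite eqxx.
- by [].
- by case.
Qed.

Lemma dragonfly_top_gt0 (R : realType) (C : real_chain R) :
  \bot < \top :> dragonfly C.
Proof.
rewrite lt0x; apply/eqP => /(congr1 (@option_of_dragonfly R C)) topE.
by have /eqP[] := chain_bot_neq_top C; apply: Some_inj.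
Qed.

(** In a chain the meet of two elements is one of them, so strict positivity
    survives finite meets; nontriviality takes care of the empty one. *)
Lemma meets_gt0 (d : Order.disp_t) (D : tbOrderType d) (I : finType)
    (A : {set I}) (f : I -> D) :
    \bot < \top :> D ->
  (forall i, i \in A -> \bot < f i) -> \bot < \meet_(i in A) f i.
Proof.
by move=> D_gt0 f_gt0; elim/big_ind: _ => // x y x_gt0 y_gt0; rewrite ltxI x_gt0.
Qed.

Theorem theorem3 (R : realType) (C : real_chain R) (Q : residuation C)
    (hQ : no_zero_divisors Q) (n : nat) (n_gt0 : (0 < n)%N)
    (mu : {set 'I_n} -> dragonfly C) (hmu : capacity mu)
    (f : 'I_n -> dragonfly C) :
  dpr_integral Q mu f = \bot%O <-> mu [set i | (\bot < f i)%O] = \bot%O.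
Proof.
set S := [set i | _]; have [_ _ mu_mono] := hmu; split=> [int0|muS0].
- have : dragonfly_tens Q (mu S) (\meet_(i in S) f i) = \bot.
    by apply/eqP; rewrite -lex0 -int0; exact: joins_sup (erefl true).
  case/(dragonfly_tens_eq0 hQ) => // meet0.
  have : \bot < \meet_(i in S) f i.
    by apply: meets_gt0 => [|i]; [exact: dragonfly_top_gt0 | rewrite inE].
  by rewrite meet0 ltxx.
- apply: big1 => A _; apply/(dragonfly_tens_eq0 hQ).
  have [AS|/subsetPn[i iA]] := boolP (A \subset S).
    by left; apply/eqP; rewrite -lex0 -muS0 mu_mono.
  rewrite inE lt0x negbK => /eqP fi0.
  by right; apply/eqP; rewrite -lex0 -fi0; apply: meets_inf.
Qed.
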